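(* Every msi-rule system $\mathtt{L}\in \mathbf{NExt}(\mathtt{KM_R})$ is axiomatisable over $\mathtt{KM_R}$ by some set of msi pre-stable canonical rules of the form $\xi(\mathfrak{H}, D^\to, D^\boxtimes)$, where $\mathfrak{H}$ is a finite fronton.
   Context: Signature $msi=\{\land,\lor,\to,\boxtimes,\bot,\top\}$. $\mathtt{KM}=\mathtt{IPCK}\oplus p\to\boxtimes p\oplus(\boxtimes p\to p)\to p\oplus\boxtimes p\to(q\lor(q\to p))$; $\mathtt{KM_R}$ is the least msi-rule system containing $/\varphi$ for $\varphi\in\mathtt{KM}$. Frontons are the algebras of $\mathtt{KM}$ (Heyting algebras with a normal operator $\boxtimes$ satisfying $a\le\boxtimes a$, $\boxtimes a\to a=a$, $\boxtimes a\le b\lor(b\to a)$). For a finite fronton $\mathfrak{H}$ and $D^\to\subseteq H\times H$, $D^\boxtimes\subseteq H$ such that $a\in D^\boxtimes$ implies $(b,a)\in D^\to$ for all $b\in H$, the msi pre-stable canonical rule $\xi(\mathfrak{H},D^\to,D^\boxtimes)$ is $\Gamma/\Delta$ with fresh variables $p_a$ ($a\in H$), where $\Gamma=\{p_0\leftrightarrow 0,p_1\leftrightarrow 1\}\cup\{p_{a\land b}\leftrightarrow p_a\land p_b,\ p_{a\lor b}\leftrightarrow p_a\lor p_b:a,b\in H\}\cup\{p_{a\to b}\leftrightarrow p_a\to p_b:(a,b)\in D^\to\}\cup\{p_{\boxtimes a}\leftrightarrow\boxtimes p_a:a\in D^\boxtimes\}$ and $\Delta=\{p_a\leftrightarrow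 p_b:a,b\in H,\ a\neq b\}$. *)

(* Defs.v *)
From HB Require Import structures.
From mathcomp Require Import all_boot all_order finmap.
From mathcomp Require Import boolp classical_sets.

Set Implicit Arguments.
Unset Strict Implicit.
Unset Printing Implicit Defensive.

Local Open Scope fset_scope.
Local Open Scope classical_set_scope.

Inductive form : Type :=
  | Var of nat
  | Bot
  | Top
  | And of form & form
  | Or of form & form
  | Imp of form & form
  | Box of form.

Definition Iff (f g : form) : form := And (Imp f g) (Imp g f).

Fixpoint form_encode (f : form) : GenTree.tree nat :=
  match f with
  | Var n => GenTree.Leaf n
  | Bot => GenTree.Node 0 [::]
  | Top => GenTree.Node 1 [::]
  | And g h => GenTree.Node 2 [:: form_encode g; form_encode h]
  | Or g h => GenTree.Node 3 [:: form_encode g; form_encode h]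
  | Imp g h => GenTree.Node 4 [:: form_encode g; form_encode h]
  | Box g => GenTree.Node 5 [:: form_encode g]
  end.

Fixpoint form_decode (t : GenTree.tree nat) : option form :=
  match t with
  | GenTree.Leaf n => Some (Var n)
  | GenTree.Node 0 [::] => Some Bot
  | GenTree.Node 1 [::] => Some Top
  | GenTree.Node 2 [:: u; v] =>
      obind (fun g => omap (And g) (form_decode v)) (form_decode u)
  | GenTree.Node 3 [:: u; v] =>
      obind (fun g => omap (Or g) (form_decode v)) (form_decode u)
  | GenTree.Node 4 [:: u; v] =>
      obind (fun g => omap (Imp g) (form_decode v)) (form_decode u)
  | GenTree.Node 5 [:: u] => omap Box (form_decode u)
  | _ => None
  end.

Lemma form_encodeK : pcancel form_encode form_decode.
Proof.
by elim=> [n|||g Hg h Hh|g Hg h Hh|g Hg h Hh|g Hg] //=; rewrite Hg //= Hh.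
Qed.

HB.instance Definition _ := Countable.copy form (pcan_type form_encodeK).

Fixpoint subst (s : nat -> form) (f : form) : form :=
  match f with
  | Var n => s n
  | Bot => Bot
  | Top => Top
  | And g h => And (subst s g) (subst s h)
  | Or g h => Or (subst s g) (subst s h)
  | Imp g h => Imp (subst s g) (subst s h)
  | Box g => Box (subst s g)
  end.

(* The schemes range over all formulas, box included, so [IPC] is the set of
   all substitution instances in this signature of intuitionistic theorems. *)
Inductive IPC : set form :=
  | IPC_K f g : IPC (Imp f (Imp g f))
  | IPC_S f g h : IPC (Imp (Imp f (Imp g h)) (Imp (Imp f g) (Imp f h)))
  | IPC_AndI f g : IPC (Imp f (Imp g (And f g)))
  | IPC_AndEl f g : IPC (Imp (And f g) f)
  | IPC_AndEr f g : IPC (Imp (And f g) g)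
  | IPC_OrIl f g : IPC (Imp f (Or f g))
  | IPC_OrIr f g : IPC (Imp g (Or f g))
  | IPC_OrE f g h : IPC (Imp (Imp f h) (Imp (Imp g h) (Imp (Or f g) h)))
  | IPC_BotE f : IPC (Imp Bot f)
  | IPC_TopI : IPC Top
  | IPC_MP f g : IPC f -> IPC (Imp f g) -> IPC g.

Record msi_logic (L : set form) : Prop := {
  logic_ipc : IPC `<=` L;
  logic_boxK :
    L (Imp (Box (Imp (Var 0) (Var 1))) (Imp (Box (Var 0)) (Box (Var 1))));
  logic_mp : forall f g, L f -> L (Imp f g) -> L g;
  logic_nec : forall f, L f -> L (Box f);
  logic_subst : forall (s : nat -> form) f, L f -> L (subst s f) }.

Definition IPCK : set form :=
  [set f | forall L : set form, msi_logic L -> L f].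

Definition logic_oplus (L X : set form) : set form :=
  [set f | forall M : set form, msi_logic M -> L `<=` M -> X `<=` M -> M f].

Definition KM : set form :=
  let p := Var 0 in let q := Var 1 in
  logic_oplus
    (logic_oplus
      (logic_oplus IPCK
        [set Imp p (Box p)])
      [set Imp (Imp (Box p) p) p])
    [set Imp (Box p) (Or q (Imp q p))].

(* [(G, D)] is the rule G / D. *)
Definition rule : Type := ({fset form} * {fset form})%type.

Definition subst_fset (s : nat -> form) (G : {fset form}) : {fset form} :=
  [fset subst s f | f in G].

Record rule_system (S : set rule) : Prop := {
  rs_structural : forall (s : nat -> form) (G D : {fset form}),
    S (G, D) -> S (subst_fset s G, subst_fset s D);
  rs_refl : forall f, S ([fset f], [fset f]);
  rs_mono : forall G D G' D' : {fset form},
    S (G, D) -> S (G `|` G', D `|` D')%fset;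
  rs_cut : forall (G D : {fset form}) f,
    S (G, f |` D)%fset -> S (f |` G, D)%fset -> S (G, D) }.

Definition axiom_rule (f : form) : rule := (fset0, [fset f]).

Record msi_rule_system (S : set rule) : Prop := {
  msi_rs_system : rule_system S;
  msi_rs_ipck : forall f, IPCK f -> S (axiom_rule f);
  msi_rs_mp : forall f g, S ([fset f; Imp f g], [fset g]);
  msi_rs_nec : forall f, S ([fset f], [fset Box f]) }.

Definition KM_R : set rule :=
  [set r | forall S : set rule,
     msi_rule_system S -> (forall f, KM f -> S (axiom_rule f)) -> S r].

Definition NExt (S : set rule) : set (set rule) :=
  [set L | msi_rule_system L /\ S `<=` L].

Definition rule_oplus (S X : set rule) : set rule :=
  [set r | forall M : set rule,
     msi_rule_system M -> S `<=` M -> X `<=` M -> M r].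

Definition axiomatised_over (S L X : set rule) : Prop := L = rule_oplus S X.

Import Order.Theory.
Local Open Scope order_scope.

HB.mixin Record isHeyting (d : Order.disp_t) H of Order.TBDistrLattice d H := {
  himp : H -> H -> H;
  himpP : forall a b c : H, (c <= himp a b) = (c `&` a <= b) }.

#[short(type="heytingType")]
HB.structure Definition Heyting (d : Order.disp_t) :=
  { H of isHeyting d H & Order.TBDistrLattice d H }.

HB.mixin Record isFronton (d : Order.disp_t) H of Heyting d H := {
  hbox : H -> H;
  hbox1 : hbox \top = \top;
  hboxI : forall a b : H, hbox (a `&` b) = hbox a `&` hbox b;
  hbox_ge : forall a : H, a <= hbox a;
  himp_hbox : forall a : H, himp (hbox a) a = a;
  hbox_le : forall a b : H, hbox a <= b `|` himp b a }.

(* The one-element algebra is not excluded. *)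
#[short(type="frontonType")]
HB.structure Definition Fronton (d : Order.disp_t) :=
  { H of isFronton d H & Heyting d H }.

#[short(type="finFrontonType")]
HB.structure Definition FinFronton (d : Order.disp_t) :=
  { H of Fronton d H & Order.FinTBDistrLattice d H }.

Section PreStableCanonicalRule.

Variables (d : Order.disp_t) (H : finFrontonType d).
Variables (Dimp : {set H * H}) (Dbox : {set H}).
(* [p a] is the index of the variable attached to [a]. *)
Variable p : H -> nat.

Let P (a : H) : form := Var (p a).

Definition psc_premises : {fset form} :=
  ([fset Iff (P \bot%O) Bot; Iff (P \top%O) Top]
   `|` [fset Iff (P (a `&` b)%O) (And (P a) (P b)) | a : H, b : H]
   `|` [fset Iff (P (a `|` b)%O) (Or (P a) (P b)) | a : H, b : H]
   `|` [fset Iff (P (himp ab.1 ab.2)) (Imp (P ab.1) (P ab.2)) | ab in Dimp]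
   `|` [fset Iff (P (hbox a)) (Box (P a)) | a in Dbox])%fset.

Definition psc_conclusions : {fset form} :=
  [fset Iff (P ab.1) (P ab.2) | ab : H * H & ab.1 != ab.2]%fset.

Definition psc_rule : rule := (psc_premises, psc_conclusions).

End PreStableCanonicalRule.

Definition psc_compatible (d : Order.disp_t) (H : finFrontonType d)
    (Dimp : {set H * H}) (Dbox : {set H}) : Prop :=
  forall a : H, a \in Dbox -> forall b : H, (b, a) \in Dimp.

(* [p] is injective because the variables attached to elements are fresh. *)
Definition is_pre_stable_canonical_rule (r : rule) : Prop :=
  exists (d : Order.disp_t) (H : finFrontonType d)
         (Dimp : {set H * H}) (Dbox : {set H}) (p : H -> nat),
    [/\ psc_compatible Dimp Dbox, injective p & r = psc_rule Dimp Dbox p].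

(* Main.v *)
Require Import Defs.
From HB Require Import structures.
From mathcomp Require Import all_boot all_order finmap.
From mathcomp Require Import boolp classical_sets.

Set Implicit Arguments.
Unset Strict Implicit.
Unset Printing Implicit Defensive.

Import Order.Theory.

(* Let M be the extension of KM_R by the pre-stable canonical rules of L. A rule
   outside M is refuted in the Lindenbaum algebra of a set T of formulas closed
   under M. The subformulas of the rule generate, under the lattice operations
   and the implications [- -> a] for the finitely many subformulas [a], a finite
   sublattice H of that algebra. A finite distributive lattice is a fronton in a
   unique way, and this fronton structure agrees with the ambient one on the
   implications and boxes of the rule: [box a] is the meet of the [b \/ (b -> a)]
   as soon as [box a] and all [b -> a] lie in H. The canonical rule of H thus
   fails in T, so it is not in M and hence not in L; and any refutation of it in
   a set closed under L transports to a refutation of the original rule. *)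

(** * The fronton structure of a finite distributive lattice *)

Section FiniteDistrLattice.
Local Open Scope order_scope.
Variables (d : Order.disp_t) (D : Order.FinTBDistrLattice.type d).
Implicit Types a b c : D.

Definition lattice_imp a b : D := \join_(c | c `&` a <= b) c.

Lemma lattice_impP a b c : (c <= lattice_imp a b) = (c `&` a <= b).
Proof.
apply/idP/idP => [cab|]; last by move=> cab; apply: joins_sup.
apply: le_trans (leI2 cab (lexx a)) _; rewrite /lattice_imp.
elim/big_ind: _ => [|x y xab yab|//]; first by rewrite meet0x le0x.
by rewrite meetUl leUx xab.
Qed.

(** The largest value that [hbox_le] allows. A join-irreducible element lies below it exactly when
    all strictly smaller join-irreducible elements lie below [a]. *)
Definition lattice_box a : D := \meet_b (b `|` lattice_imp b a).

Lemma lattice_box_le a b : lattice_box a <= b `|` lattice_imp b a.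
Proof. exact: meets_inf. Qed.

Lemma lattice_box1 : lattice_box \top = \top.
Proof.
apply/le_anti; rewrite lex1 /=; apply/meetsP => b _.
by apply: lexU2; rewrite lattice_impP lex1 orbT.
Qed.

Lemma lattice_boxI a b : lattice_box (a `&` b) = lattice_box a `&` lattice_box b.
Proof.
rewrite /lattice_box -big_split /=; apply: eq_bigr => c _.
rewrite -joinIr; congr (_ `|` _); apply/eqP; rewrite eq_le lexI !lattice_impP.
have [H1 H2] : lattice_imp c a `&` c <= a /\ lattice_imp c b `&` c <= b.
  by rewrite -!lattice_impP.
have H3 : lattice_imp c (a `&` b) `&` c <= a `&` b by rewrite -lattice_impP.
move: H3; rewrite lexI => /andP[-> ->] /=; rewrite lexI.
rewrite (le_trans _ H1) ?(le_trans _ H2) // leI2 ?leIl ?leIr //.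
Qed.

Lemma lattice_box_ge a : a <= lattice_box a.
Proof. by apply/meetsP => b _; apply: lexU2; rewrite lattice_impP leIl orbT. Qed.

(* An element minimal among those below [box a -> a] but not below [a] would
   be join-prime, hence below [box a]. *)
Lemma lattice_imp_box a : lattice_imp (lattice_box a) a = a.
Proof.
set c := lattice_imp _ _; apply/eqP; rewrite eq_le lattice_impP leIl andbT.
apply: contraT => cNa.
case: (@arg_minnP _ c (fun b => (b <= c) && ~~ (b <= a))
  (fun b => #|[pred x | x <= b]|)) => [|b /andP[bc bNa] bmin].
  by rewrite lexx.
suff bbox : b <= lattice_box a.
  by case/negP: bNa; move: bc; rewrite lattice_impP meet_l.
apply/meetsP => x _; apply: lexU2; rewrite lattice_impP.
case: (boolP (b <= x)) => //= bNx; apply: contraT => bxNa.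
have := bmin (b `&` x); rewrite bxNa (le_trans (leIl _ _) bc) => /(_ isT).
rewrite leqNgt => /negP[]; apply: proper_card; apply/fintype.properP; split.
  by apply/fintype.subsetP => y; rewrite !inE lexI => /andP[].
by exists b; rewrite !inE ?lexx // lexI lexx.
Qed.
End FiniteDistrLattice.

Local Open Scope classical_set_scope.

(** * Intuitionistic theories and a tactic for intuitionistic consequence *)

Record thy (T : set form) : Prop := Thy {
  thy_ipc : IPC `<=` T;
  thy_mp : forall f g, T (Imp f g) -> T f -> T g }.

Section Theory.
Variables (T : set form) (hT : thy T).
Implicit Types f g h : form.

Lemma thy_weak f g : T g -> T (Imp f g).
Proof. exact: thy_mp (thy_ipc hT (IPC_K _ _)). Qed.

Lemma thy_refl f : T (Imp f f).
Proof.
have S := thy_ipc hT (IPC_S f (Imp f f) f).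
by apply: thy_mp (thy_mp hT S _) _ => //; apply: thy_ipc => //; apply: IPC_K.
Qed.

Lemma thy_extend f : thy [set g | T (Imp f g)].
Proof.
split=> [g Ig|g h /= fgh fg]; first exact: thy_weak (thy_ipc hT Ig).
exact: thy_mp (thy_mp hT (thy_ipc hT (IPC_S _ _ _)) fgh) fg.
Qed.

(** Deduction theorem, with an arbitrary larger theory [T'] as the context extended by [f].
    Assumptions become facts about the current theory, which [ipc] carries along the inclusion. *)
Lemma thy_imp f g :
  (forall T', thy T' -> T `<=` T' -> T' f -> T' g) -> T (Imp f g).
Proof.
move=> H; apply: (H _ (thy_extend f)); last exact: thy_refl.
by move=> h; exact: thy_weak.
Qed.

Lemma thy_andI f g : T f -> T g -> T (And f g).
Proof.
by move=> Tf; apply: thy_mp (thy_mp hT (thy_ipc hT (IPC_AndI f g)) Tf).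
Qed.

Lemma thy_andE f g : T (And f g) -> T f /\ T g.
Proof.
move=> fg; split; [have := IPC_AndEl f g | have := IPC_AndEr f g];
  by move=> /(thy_ipc hT)/(thy_mp hT); apply.
Qed.

Lemma thy_orIl f g : T f -> T (Or f g).
Proof. exact: thy_mp (thy_ipc hT (IPC_OrIl _ _)). Qed.

Lemma thy_orIr f g : T g -> T (Or f g).
Proof. exact: thy_mp (thy_ipc hT (IPC_OrIr _ _)). Qed.

Lemma thy_orE f g h : T (Or f g) ->
  (forall T', thy T' -> T `<=` T' -> T' f -> T' h) ->
  (forall T', thy T' -> T `<=` T' -> T' g -> T' h) -> T h.
Proof.
move=> fg /thy_imp fh /thy_imp gh.
have := thy_mp hT (thy_ipc hT (IPC_OrE f g h)) fh.
by move=> /(thy_mp hT)/(_ gh)/(thy_mp hT); apply.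
Qed.

Lemma thy_botE f : T Bot -> T f.
Proof. exact: thy_mp (thy_ipc hT (IPC_BotE _)). Qed.

Lemma thy_top : T Top.
Proof. exact: thy_ipc hT _ IPC_TopI. Qed.

End Theory.

Section ImpLeft.
Variables (T : set form) (hT : thy T).
Implicit Types f g h k : form.

Lemma thy_curry f g h : T (Imp (And f g) h) -> T (Imp f (Imp g h)).
Proof.
move=> fgh; apply: thy_imp => // T1 h1 s1 f1; apply: thy_imp => // T2 h2 s2 g2.
by apply: thy_mp (s2 _ (s1 _ fgh)) _ => //; apply: thy_andI => //; apply: s2.
Qed.

Lemma thy_impOr f g h : T (Imp (Or f g) h) -> T (Imp f h) /\ T (Imp g h).
Proof.
move=> fgh; split; apply: thy_imp => // T1 h1 s1 f1;
  apply: (thy_mp h1 (s1 _ fgh)); [exact: thy_orIl | exact: thy_orIr].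
Qed.

(** In the left rule of LJT for [(f -> g) -> h], this replaces the hypothesis by the smaller
    [g -> h] while [f -> g] is being proved, which is what keeps the search finite. *)
Lemma thy_impImp f g h : T (Imp (Imp f g) h) -> T (Imp g h).
Proof.
move=> fgh; apply: thy_imp => // T1 h1 s1 g1.
by apply: (thy_mp h1 (s1 _ fgh)); apply: thy_weak.
Qed.

End ImpLeft.

Ltac thy_push T s :=
  repeat match goal with H : T ?f |- _ => apply s in H end.

(* Dyckhoff's contraction-free sequent calculus LJT, hence terminating. *)
Ltac ipc :=
  unfold Iff in *;
  lazymatch goal with |- ?T ?goal =>
  match goal with
  | H : T goal |- _ => exact H
  | H : T Bot, hT : thy T |- _ => exact (thy_botE hT _ H)
  | hT : thy T |- T Top => exact (thy_top hT)
  | H : T (And _ _), hT : thy T |- _ => apply (thy_andE hT) in H; destruct H; ipc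
  | H : T Top |- _ => clear H; ipc
  | H : T (Imp Bot _) |- _ => clear H; ipc
  | H : T (Imp Top _), hT : thy T |- _ =>
      apply (fun H => thy_mp hT H (thy_top hT)) in H; ipc
  | H : T (Imp ?f _), H' : T ?f, hT : thy T |- _ =>
      apply (fun H => thy_mp hT H H') in H; ipc
  | H : T (Imp (And _ _) _), hT : thy T |- _ => apply (thy_curry hT) in H; ipc
  | H : T (Imp (Or _ _) _), hT : thy T |- _ =>
      apply (thy_impOr hT) in H; destruct H; ipc
  | hT : thy T |- T (And _ _) => apply (thy_andI hT); ipc
  | hT : thy T |- T (Imp _ _) =>
      let T1 := fresh "T" in let h1 := fresh "h" in let s1 := fresh "s" in
      apply (thy_imp hT); intros T1 h1 s1 ?; thy_push T s1; ipc
  | H : T (Or _ _), hT : thy T |- _ =>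
      let T1 := fresh "T" in let h1 := fresh "h" in let s1 := fresh "s" in
      apply (thy_orE hT H); clear H; intros T1 h1 s1 ?; thy_push T s1; ipc
  | hT : thy T |- T (Or _ _) => apply (thy_orIl hT); ipc
  | hT : thy T |- T (Or _ _) => apply (thy_orIr hT); ipc
  | H : T (Imp (Imp ?f ?g) ?h), hT : thy T |- _ =>
      let K := fresh "K" in
      assert (K : T (Imp f g));
      [ apply (thy_impImp hT) in H; ipc
      | apply (fun H => thy_mp hT H K) in H; clear K; ipc ]
  end end.

(** * Finiteness of lattices closed under implications into a finite set *)

(** Consequents are confined to [A]: closing under all implications can give infinitely many classes
    already from one generator, as the Rieger-Nishimura lattice shows. *)
Inductive closure (S A : set form) : set form :=
  | closure_gen f : S f -> closure S A f
  | closure_bot : closure S A Bot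
  | closure_top : closure S A Top
  | closure_and f g : closure S A f -> closure S A g -> closure S A (And f g)
  | closure_or f g : closure S A f -> closure S A g -> closure S A (Or f g)
  | closure_imp f a : closure S A f -> A a -> closure S A (Imp f a).

Section Finiteness.
Variables (T : set form) (hT : thy T).
Implicit Types (f g a b x z : form) (B A : seq form).

Definition finite_mod (C : set form) :=
  exists s : seq form, forall f, C f -> exists2 g, g \in s & T (Iff f g).

Notation lat B := (closure [set` B] set0).

(** By distributivity the expressions [u \/ (v /\ a)] are stable under meet and join, so they
    exhaust the lattice polynomials in [a]. *)
Lemma lat_cons a B f : lat (a :: B) f ->
  exists u v, [/\ lat B u, lat B v & T (Iff f (Or u (And v a)))].
Proof.
elim=> {f} [f /=|||f g _ [u [v [? ? ?]]] _ [u' [v' [? ? ?]]]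
  |f g _ [u [v [? ? ?]]] _ [u' [v' [? ? ?]]]|//].
- rewrite inE => /predU1P[->|fB].
    exists Bot, Top; split; [exact: closure_bot|exact: closure_top|ipc].
  exists f, Bot; split; [exact: closure_gen|exact: closure_bot|ipc].
- exists Bot, Bot; split; [exact: closure_bot|exact: closure_bot|ipc].
- exists Top, Bot; split; [exact: closure_top|exact: closure_bot|ipc].
- exists (And u u'), (Or (And u v') (Or (And v u') (And v v'))); split; last ipc;
    by do ?[apply: closure_and | apply: closure_or].
- exists (Or u u'), (Or v v'); split; last ipc; exact: closure_or.
Qed.

Lemma finite_lat B : finite_mod (lat B).
Proof.
elim: B => [|a B [r rP]].
  exists [:: Bot; Top] => f; elim=> {f} [//|||f g _ [f' + ?] _ [g' g'BT ?]
    |f g _ [f' + ?] _ [g' g'BT ?]|//].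
  - by exists Bot; rewrite ?inE ?eqxx //; ipc.
  - by exists Top; rewrite ?inE ?eqxx ?orbT //; ipc.
  - rewrite !inE => /orP[]/eqP ?; subst; last by exists g' => //; ipc.
    by exists Bot; rewrite ?inE ?eqxx //; ipc.
  - rewrite !inE => /orP[]/eqP ?; subst; first by exists g' => //; ipc.
    by exists Top; rewrite ?inE ?eqxx ?orbT //; ipc.
exists [seq Or u (And v a) | u <- r, v <- r] => f.
case/lat_cons=> u [v [/rP[u' ru ?] /rP[v' rv ?] ?]].
exists (Or u' (And v' a)); last ipc.
by apply/allpairsP; exists (u', v').
Qed.

Lemma iff_trans f g h : T (Iff f g) -> T (Iff g h) -> T (Iff f h).
Proof. by move=> *; ipc. Qed.

Lemma iff_sym f g : T (Iff f g) -> T (Iff g f).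
Proof. by move=> *; ipc. Qed.

Lemma iff_impl f g h : T (Iff f g) -> T (Iff (Imp f h) (Imp g h)).
Proof. by move=> *; ipc. Qed.

Section Step.
Variables (A B r : seq form) (a : form).
Hypothesis rP : forall f,
  closure [set` B] [set` [seq b <- A | b != a]] f ->
  exists2 g, g \in r & T (Iff f g).

(* Modulo [a], implications into [a] are trivial. *)
Lemma closure_remove x : closure [set` B] [set` A] x ->
  exists2 z, z \in r & T (Imp a (Iff x z)).
Proof.
suff H : closure [set` B] [set` A] x ->
    exists2 z, closure [set` B] [set` [seq b <- A | b != a]] z &
      T (Imp a (Iff x z)).
  by move=> /H[z /rP[z' z'r ?] ?]; exists z' => //; ipc.
elim=> {x} [f ?|||f g _ [f' ? ?] _ [g' ? ?]
  |f g _ [f' ? ?] _ [g' ? ?]|f b _ [f' ? ?] /= bA].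
- by exists f; [exact: closure_gen|ipc].
- by exists Bot; [exact: closure_bot|ipc].
- by exists Top; [exact: closure_top|ipc].
- by exists (And f' g'); [exact: closure_and|ipc].
- by exists (Or f' g'); [exact: closure_or|ipc].
- have [->|ba] := eqVneq b a; first by exists Top; [exact: closure_top|ipc].
  exists (Imp f' b); last ipc.
  by apply: closure_imp => //=; rewrite mem_filter ba.
Qed.

(** If [a] were below [b], then relative to [a] the implication [x -> b] would be the classical
    [(x -> a) \/ b]. The factor [a -> (z -> b)] corrects for the general case; there [z], from a
    finite list, replaces [x], with which it agrees modulo [a]. *)
Let rel_imp x b z : T (Imp a (Iff x z)) ->
  T (Iff (Imp (Imp x b) a) (Imp (And (Or (Imp x a) b) (Imp a (Imp z b))) a)).
Proof. by move=> *; ipc. Qed.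

Let rel_neg x b f :
  T (Iff (Imp (Imp (And (Or (Imp x a) b) f) a) a)
         (Imp (Or (And x (Imp b a)) (Imp f a)) a)).
Proof. by ipc. Qed.

Let rel_congr p q b f : T (Iff (Imp p a) (Imp q a)) ->
  T (Iff (Imp (And (Or p b) f) a) (Imp (And (Or q b) f) a)).
Proof. by move=> *; ipc. Qed.

Let rel_congr_neg p q b f : T (Iff (Imp p a) (Imp q a)) ->
  T (Iff (Imp (Or (And p b) f) a) (Imp (Or (And q b) f) a)).
Proof. by move=> *; ipc. Qed.

(** The third block of [F] supplies the factors of [rel_imp]; the implications [f -> a] supply
    complements, so that negations, too, are lattice combinations of the list. *)
Definition traces : seq form :=
  let F := B ++ A ++ [seq Imp a (Imp z b) | z <- r, b <- A] in
  F ++ [seq Imp f a | f <- F].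

(* [x |-> (x -> a) -> a] maps into a Boolean algebra with complement
   [x |-> x -> a]; this records [x] and its complement there. *)
Lemma closure_trace x : closure [set` B] [set` A] x ->
  exists u v, [/\ lat traces u, lat traces v,
    T (Iff (Imp x a) (Imp u a)) & T (Iff (Imp (Imp x a) a) (Imp v a))].
Proof.
have gen f : f \in B ++ A ++ [seq Imp a (Imp z b) | z <- r, b <- A] ->
    lat traces f /\ lat traces (Imp f a).
  move=> fF; split; apply: closure_gen; rewrite /= mem_cat; first by rewrite fF.
  by apply/orP; right; apply/mapP; exists f.
elim=> {x} [f ?|||f g _ [u [v [? ? ? ?]]] _ [u' [v' [? ? ? ?]]]
  |f g _ [u [v [? ? ? ?]]] _ [u' [v' [? ? ? ?]]]|x b xC [u [v [? ? U V]]] /= bA].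
- have [|? ?] := gen f; first by rewrite mem_cat; apply/orP; left.
  by exists f, (Imp f a); split=> //; ipc.
- exists Bot, Top; split; [exact: closure_bot|exact: closure_top|ipc|ipc].
- exists Top, Bot; split; [exact: closure_top|exact: closure_bot|ipc|ipc].
- exists (And u u'), (Or v v'); split; [exact: closure_and|exact: closure_or|ipc|ipc].
- exists (Or u u'), (And v v'); split; [exact: closure_or|exact: closure_and|ipc|ipc].
- have [z zr Z] := closure_remove xC.
  have [|gf gfa] := gen (Imp a (Imp z b)).
    by rewrite !mem_cat; do 2![apply/orP; right]; apply/allpairsP; exists (z, b).
  have [|gb gba] := gen b; first by rewrite !mem_cat bA orbT.
  (* Read off from [rel_imp] and [rel_neg], with [v] in place of [x -> a] by [V] and [u] in place of
     [x] by [U]. *)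
  exists (And (Or v b) (Imp a (Imp z b))),
    (Or (And u (Imp b a)) (Imp (Imp a (Imp z b)) a)).
  split; [|by apply: closure_or => //; apply: closure_and| |].
  + by apply: closure_and => //; apply: closure_or.
  + exact: iff_trans (rel_imp b Z) (rel_congr _ _ V).
  + apply: iff_trans (iff_impl _ (rel_imp b Z)) _.
    exact: iff_trans (rel_neg _ _ _) (rel_congr_neg _ _ U).
Qed.

Lemma finite_implications :
  finite_mod [set Imp x a | x in closure [set` B] [set` A]].
Proof.
have [q qP] := finite_lat traces.
exists [seq Imp g a | g <- q] => _ [x /closure_trace[u [v [/qP[g gq ?] _ ? _]]] <-].
by exists (Imp g a); [apply/mapP; exists g|ipc].
Qed.

End Step.

(** Induction on the size of [A]. Without [a] the closure is finite, so there are finitely many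
    implications into [a]; with all of these as extra generators, the full closure lies, up to
    equivalence, in a finitely generated lattice. *)
Lemma finite_closure B A : finite_mod (closure [set` B] [set` A]).
Proof.
have [n] := ubnP (size A); elim: n A => // n IHn A; rewrite ltnS => An.
have /choice[q qP] a : exists q : seq form, a \in A ->
    forall x, closure [set` B] [set` A] x ->
      exists2 g, g \in q & T (Iff (Imp x a) g).
  have [aA|] := boolP (a \in A); last by exists [::].
  have [|r rP] := IHn [seq b <- A | b != a].
    apply: leq_trans An; rewrite size_filter -(count_predC (fun b => b != a)).
    rewrite -[X in (X < _)%N]addn0 ltn_add2l -has_count.
    by apply/hasP; exists a => //=; rewrite eqxx.
  have [q qP] := finite_implications rP.
  by exists q => _ x xC; apply: qP; exists x.
have [r rP] := finite_lat (B ++ flatten (map q A)).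
exists r => f fC.
suff [g /rP[g' g'r ?] ?] : exists2 g, lat (B ++ flatten (map q A)) g & T (Iff f g).
  by exists g' => //; ipc.
elim: fC => {f} [f fB|||f g _ [f' ? ?] _ [g' ? ?]
  |f g _ [f' ? ?] _ [g' ? ?]|x a xC _ /= aA].
- exists f; last ipc.
  by apply: closure_gen; rewrite /= mem_cat; apply/orP; left.
- by exists Bot; [exact: closure_bot|ipc].
- by exists Top; [exact: closure_top|ipc].
- by exists (And f' g'); [exact: closure_and|ipc].
- by exists (Or f' g'); [exact: closure_or|ipc].
- have [g gq ?] := qP a aA x xC.
  exists g => //; apply: closure_gen; rewrite /= mem_cat; apply/orP; right.
  by apply/flatten_mapP; exists a.
Qed.

End Finiteness.

(** * Finite sublattices of the Lindenbaum algebra *)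

(** One formula is kept per class, instead of the classes themselves, so that the carrier
    [seq_sub G] is a finite type at once. *)
Record sublattice_section (T : set form) (G : seq form) : Prop := {
  section_inj : forall f g, f \in G -> g \in G -> T (Iff f g) -> f = g;
  section_bot : exists2 h, h \in G & T (Iff Bot h);
  section_top : exists2 h, h \in G & T (Iff Top h);
  section_and : forall f g, f \in G -> g \in G ->
    exists2 h, h \in G & T (Iff (And f g) h);
  section_or : forall f g, f \in G -> g \in G ->
    exists2 h, h \in G & T (Iff (Or f g) h) }.

Lemma sublattice_section_exists (T C : set form) : thy T -> finite_mod T C ->
  C Bot -> C Top -> (forall f g, C f -> C g -> C (And f g)) ->
  (forall f g, C f -> C g -> C (Or f g)) ->
  exists G, [/\ sublattice_section T G,
    forall g, g \in G -> C g & forall f, C f -> exists2 g, g \in G & T (Iff f g)].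
Proof.
move=> hT [s sP] CB CT CA CO.
suff [G [Ginj GC GP]] : exists G : seq form,
    [/\ forall f g, f \in G -> g \in G -> T (Iff f g) -> f = g,
    forall g, g \in G -> C g & forall f, C f -> exists2 g, g \in G & T (Iff f g)].
  exists G; split=> //; split=> // [||f g /GC fC /GC gC|f g /GC fC /GC gC];
    by apply: GP; auto.
suff [G [Ginj GC GP]] : exists G : seq form,
    [/\ forall f g, f \in G -> g \in G -> T (Iff f g) -> f = g,
    forall g, g \in G -> C g &
    forall f h, C f -> h \in s -> T (Iff f h) -> exists2 g, g \in G & T (Iff f g)].
  by exists G; split=> // f /[dup] fC /sP[h hs /GP]; apply.
elim: s {sP} => [|k s [G [Ginj GC GP]]]; first by exists [::]; split.
case: (EM (exists2 f, C f & T (Iff f k) /\ forall g, g \in G -> ~ T (Iff f g))).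
  (* [f] is added rather than [k], which may lie outside [C]. *)
  case=> f fC [fk fG]; exists (f :: G); split=> [x y|x|x h xC].
  - rewrite !inE => /predU1P[->|xG] /predU1P[->|yG] // xy; last exact: Ginj.
      by case: (fG _ yG).
    by case: (fG _ xG); ipc.
  - by rewrite inE => /predU1P[->|/GC].
  - rewrite inE => /predU1P[->|hs] xh.
      by exists f; rewrite ?inE ?eqxx //; ipc.
    by have [g gG ?] := GP _ _ xC hs xh; exists g; rewrite ?inE ?gG ?orbT.
move=> H; exists G; split=> // x h xC; rewrite inE => /predU1P[->|hs] xh; last first.
  exact: GP xC hs xh.
apply: contrapT => xG; apply: H; exists x => //; split=> // g gG xg.
by apply: xG; exists g.
Qed.

Fact quotient_display : Order.disp_t. Proof. exact: (Order.Disp tt tt). Qed.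

Section Quotient.
Variables (T : set form) (hT : thy T) (G : seq form) (hG : sublattice_section T G).

(** The [let] bindings make the type depend on [hT] and [hG], so that the order instances, whose
    proofs use them, can be inferred from the type. *)
Definition quotient : Type := let _ := hT in let _ := hG in seq_sub G.
HB.instance Definition _ := Finite.copy quotient (seq_sub G).
HB.instance Definition _ := SubType.copy quotient (seq_sub G).
Implicit Types x y z : quotient.

Definition repr x : form := val x.

Lemma repr_in x : repr x \in G.
Proof. exact: valP. Qed.

Lemma quotient_inj x y : T (Iff (repr x) (repr y)) -> x = y.
Proof. by move=> xy; apply/val_inj/(section_inj hG) => //; apply: repr_in. Qed.

Lemma class_subproof f : exists x : quotient,
  (exists2 h, h \in G & T (Iff f h)) -> T (Iff f (repr x)).
Proof.
have [[h hh fh]|] := EM (exists2 h, h \in G & T (Iff f h)).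
  by exists (SeqSub hh).
by move=> fG; have [h hh _] := section_bot hG; exists (SeqSub hh) => /fG.
Qed.

(* Junk value when [f] is not [T]-equivalent to a member of [G]. *)
Definition class f : quotient := projT1 (cid (class_subproof f)).

Lemma classP f : (exists2 h, h \in G & T (Iff f h)) -> T (Iff f (repr (class f))).
Proof. exact: projT2 (cid (class_subproof f)). Qed.

Let le x y := `[< T (Imp (repr x) (repr y)) >].
Let meet x y := class (And (repr x) (repr y)).
Let join x y := class (Or (repr x) (repr y)).

Let meetE x y : T (Iff (And (repr x) (repr y)) (repr (meet x y))).
Proof. by apply/classP/(section_and hG); apply: repr_in. Qed.

Let joinE x y : T (Iff (Or (repr x) (repr y)) (repr (join x y))).
Proof. by apply/classP/(section_or hG); apply: repr_in. Qed.

Let le_refl : reflexive le.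
Proof. by move=> x; apply/asboolP; ipc. Qed.

Let le_anti : antisymmetric le.
Proof.
by move=> x y /andP[/asboolP ? /asboolP ?]; apply: quotient_inj; ipc.
Qed.

Let le_trans : transitive le.
Proof. by move=> y x z /asboolP ? /asboolP ?; apply/asboolP; ipc. Qed.

HB.instance Definition _ :=
  Order.Le_isPOrder.Build quotient_display quotient le_refl le_anti le_trans.

Let meetP x y z : le x (meet y z) = le x y && le x z.
Proof.
have ? := meetE y z; apply/asboolP/andP => [?|[/asboolP ? /asboolP ?]]; last ipc.
by split; apply/asboolP; ipc.
Qed.

Let joinP x y z : le (join x y) z = le x z && le y z.
Proof.
have ? := joinE x y; apply/asboolP/andP => [?|[/asboolP ? /asboolP ?]]; last ipc.
by split; apply/asboolP; ipc.
Qed.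

HB.instance Definition _ :=
  Order.POrder_MeetJoin_isLattice.Build quotient_display quotient meetP joinP.

Let meetUl : @left_distributive quotient quotient meet join.
Proof.
move=> x y z; apply: quotient_inj.
have ? := meetE (join x y) z; have ? := joinE x y.
by have ? := joinE (meet x z) (meet y z); have ? := meetE x z; have ? := meetE y z; ipc.
Qed.

HB.instance Definition _ :=
  Order.Lattice_Meet_isDistrLattice.Build quotient_display quotient meetUl.

Let bot_le x : le (class Bot) x.
Proof. by have ? := classP (section_bot hG); apply/asboolP; ipc. Qed.

Let le_top x : le x (class Top).
Proof. by have ? := classP (section_top hG); apply/asboolP; ipc. Qed.

HB.instance Definition _ :=
  Order.hasBottom.Build quotient_display quotient bot_le.
HB.instance Definition _ :=
  Order.hasTop.Build quotient_display quotient le_top.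
HB.instance Definition _ := isHeyting.Build quotient_display quotient
  (@lattice_impP _ quotient).
HB.instance Definition _ := isFronton.Build quotient_display quotient
  (@lattice_box1 _ quotient) (@lattice_boxI _ quotient) (@lattice_box_ge _ quotient)
  (@lattice_imp_box _ quotient) (@lattice_box_le _ quotient).

End Quotient.

(** * KM theories and the operations of the quotient *)

(** Such sets need not be closed under substitution, so the axioms of KM appear as schemes. *)
Record KM_theory (T : set form) : Prop := {
  KM_thy : thy T;
  KM_nec : forall f, T f -> T (Box f);
  KM_boxK : forall f g, T (Imp (Box (Imp f g)) (Imp (Box f) (Box g)));
  KM_box_ge : forall f, T (Imp f (Box f));
  KM_imp_box : forall f, T (Imp (Imp (Box f) f) f);
  KM_box_le : forall f g, T (Imp (Box f) (Or g (Imp g f))) }.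

Lemma iff_box T f g : KM_theory T -> T (Iff f g) -> T (Iff (Box f) (Box g)).
Proof.
move=> hT; have h := KM_thy hT; case/(thy_andE h) => /(KM_nec hT) fg /(KM_nec hT) gf.
by apply: thy_andI => //; apply: (thy_mp h (KM_boxK hT _ _)).
Qed.

Section QuotientOperations.
Variables (T : set form) (hT : thy T) (G : seq form) (hG : sublattice_section T G).
Notation H := (quotient hT hG).
Implicit Types x y : H.

Lemma repr_bot : T (Iff Bot (repr (\bot%O : H))).
Proof. exact: classP (section_bot hG). Qed.

Lemma repr_top : T (Iff Top (repr (\top%O : H))).
Proof. exact: classP (section_top hG). Qed.

Lemma repr_meet x y : T (Iff (And (repr x) (repr y)) (repr (x `&` y)%O)).
Proof. by apply: (@classP T hT G hG); apply: (section_and hG); apply: repr_in. Qed.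

Lemma repr_join x y : T (Iff (Or (repr x) (repr y)) (repr (x `|` y)%O)).
Proof. by apply: (@classP T hT G hG); apply: (section_or hG); apply: repr_in. Qed.

Lemma quotient_leP x y : reflect (T (Imp (repr x) (repr y))) (x <= y)%O.
Proof. exact: asboolP. Qed.

Lemma quotient_meet_leP x y z :
  reflect (T (Imp (And (repr x) (repr y)) (repr z))) (x `&` y <= z)%O.
Proof.
have := repr_meet x y; move: (x `&` y)%O => m ?.
by apply: (iffP (quotient_leP _ _)) => ?; ipc.
Qed.

Lemma quotient_le_joinP x y z :
  reflect (T (Imp (repr x) (Or (repr y) (repr z)))) (x <= y `|` z)%O.
Proof.
have := repr_join y z; move: (y `|` z)%O => m ?.
by apply: (iffP (quotient_leP _ _)) => ?; ipc.
Qed.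

Lemma repr_himp x y : (exists2 h, h \in G & T (Iff (Imp (repr x) (repr y)) h)) ->
  T (Iff (Imp (repr x) (repr y)) (repr (himp x y))).
Proof.
move=> /(@classP T hT G hG); set k := class hT hG _ => xyk.
have : (himp x y `&` x <= y)%O by rewrite -himpP.
have : (k <= himp x y)%O by rewrite himpP; apply/quotient_meet_leP; ipc.
by move=> /quotient_leP ? /quotient_meet_leP ?; ipc.
Qed.

(** By [KM_box_le] the ambient box is below each of the bounds whose meet is [hbox x]; this gives
    one inequality. *)
Lemma repr_hbox x : KM_theory T ->
  (forall y, exists2 h, h \in G & T (Iff (Imp (repr y) (repr x)) h)) ->
  (exists2 h, h \in G & T (Iff (Box (repr x)) h)) ->
  T (Iff (Box (repr x)) (repr (hbox x))).
Proof.
move=> KMT xI /(@classP T hT G hG); set k := class hT hG _ => xk.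
have /quotient_leP ? : (k <= hbox x)%O.
  apply/meetsP => y _; apply/quotient_le_joinP.
  have := repr_himp (xI y); have := KM_box_le KMT (repr x) (repr y).
  by rewrite -[lattice_imp _ _]/(himp y x); move: (himp y x) => h ? ?; ipc.
(* Converse inequality: at the class [k] of the box, [k -> x] collapses to [x] by [KM_imp_box], and
   [x] is below its box. *)
have /quotient_le_joinP ? := hbox_le x k; have ? := repr_himp (xI k).
by have ? := KM_box_ge KMT (repr x); have ? := KM_imp_box KMT (repr x); ipc.
Qed.

End QuotientOperations.

(** * Lindenbaum's lemma for multiple-conclusion rules *)

Definition closed_under (M : set rule) (T : set form) :=
  forall G D : {fset form}, M (G, D) -> (forall f, f \in G -> T f) ->
  exists2 f, f \in D & T f.

Section Lindenbaum.
Variables (M : set rule) (hM : rule_system M) (G0 D0 : {fset form}).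
Hypothesis r0 : ~ M (G0, D0).
Local Open Scope fset_scope.

Fixpoint lindenbaum_stage n : {fset form} * {fset form} :=
  if n is n'.+1 then
    let: (G, D) := lindenbaum_stage n' in
    if choice.unpickle n' is Some f then
      if `[< M (f |` G, D) >] then (G, f |` D) else (f |` G, D)
    else (G, D)
  else (G0, D0).

Let G n := (lindenbaum_stage n).1.
Let D n := (lindenbaum_stage n).2.

(** If adding [f] to either side gave a rule in [M], cut would put the previous stage in [M]. *)
Let stage_not n : ~ M (G n, D n).
Proof.
rewrite /G /D; elim: n => //= n; case: (lindenbaum_stage n) => G1 D1 /= GD.
case: (choice.unpickle n) => // f; case: asboolP => //= fGD GfD.
exact: GD (rs_cut hM GfD fGD).
Qed.

Let stage_mono m n : m <= n -> G m `<=` G n /\ D m `<=` D n.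
Proof.
move=> /subnK <-; elim: (n - m) => [|k [IH1 IH2]]; first by split.
suff [H1 H2] : G (k + m) `<=` G (k + m).+1 /\ D (k + m) `<=` D (k + m).+1.
  by rewrite addSn; split; [apply: fsubset_trans IH1 H1|apply: fsubset_trans IH2 H2].
rewrite /G /D /=; case: (lindenbaum_stage _) => G1 D1 /=.
by case: (choice.unpickle _) => // f; case: asboolP => //= _; split=> //; apply: fsubsetU1.
Qed.

Let stage_total f : exists n, f \in G n \/ f \in D n.
Proof.
exists (choice.pickle f).+1; rewrite /G /D /=; case: (lindenbaum_stage _) => G1 D1.
by rewrite choice.pickleK; case: asboolP => /= _; [right|left]; rewrite fset1U1.
Qed.

(** The premises of the limit form [T]. Rules are finite, so a rule of [M] violated by [T] is
    already contained in some stage, against [stage_not]. *)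
Lemma lindenbaum : exists T : set form, [/\ closed_under M T,
  forall f, f \in G0 -> T f & forall f, f \in D0 -> ~ T f].
Proof.
have disj m n f : f \in G m -> f \in D n -> False.
  move=> fG fD; apply: (@stage_not (maxn m n)).
  have [/fsubsetP/(_ _ fG) fG' _] := stage_mono (leq_maxl m n).
  have [_ /fsubsetP/(_ _ fD) fD'] := stage_mono (leq_maxr m n).
  have := rs_mono hM (G (maxn m n)) (D (maxn m n)) (rs_refl hM f).
  by rewrite (fsetUidPr _ _ _) ?fsub1set // (fsetUidPr _ _ _) ?fsub1set.
exists [set f | exists n, f \in G n]; split=> [G1 D1 r1 G1T|f fG0|f fD0 [n fG]].
- apply: contrapT => D1T.
  have D1D f : f \in D1 -> exists n, f \in D n.
    move=> fD1; have [n [fG|fD]] := stage_total f; last by exists n.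
    by case: D1T; exists f => //; exists n.
  have up (F : nat -> {fset form}) (S : {fset form}) :
      (forall m n, m <= n -> F m `<=` F n) ->
      (forall f, f \in S -> exists n, f \in F n) -> exists n, S `<=` F n.
    move=> Fmono; elim/finSet_rect: S => S IH SF.
    have [->|[f fS]] := fset_0Vmem S; first by exists 0; apply: fsub0set.
    have [n fn] := SF _ fS.
    have [|g gS|m Sm] := IH (S `\ f); first exact: fproperD1.
      by apply: SF; move: gS; rewrite !inE => /andP[].
    exists (maxn m n); apply/fsubsetP => g gS; have [->|gf] := eqVneq g f.
      exact: (fsubsetP (Fmono _ _ (leq_maxr m n))).
    apply: (fsubsetP (Fmono _ _ (leq_maxl m n))); apply: (fsubsetP Sm).
    by rewrite !inE gf.
  have [m G1m] := up G G1 (fun m n mn => (stage_mono mn).1) G1T.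
  have [n D1n] := up D D1 (fun m n mn => (stage_mono mn).2) D1D.
  apply: (@stage_not (maxn m n)).
  have := rs_mono hM (G (maxn m n)) (D (maxn m n)) r1.
  rewrite (fsetUidPr _ _ _); last first.
    exact: fsubset_trans G1m (stage_mono (leq_maxl m n)).1.
  rewrite (fsetUidPr _ _ _) //.
  exact: fsubset_trans D1n (stage_mono (leq_maxr m n)).2.
- by exists 0.
- exact: disj n 0 f fG fD0.
Qed.

End Lindenbaum.

Lemma closed_under_KM_theory M T : msi_rule_system M -> KM_R `<=` M ->
  closed_under M T -> KM_theory T.
Proof.
move=> hM KM_M MT.
have ax f : KM f -> T f.
  move=> Kf; have [|//|g] := MT fset0 [fset f]%fset.
    by apply: KM_M => S hS; apply.
  by rewrite inE => /eqP ->.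
have mp f g : T (Imp f g) -> T f -> T g.
  move=> Tfg Tf; have [h|h] := MT _ _ (msi_rs_mp hM f g).
    by rewrite !inE => /orP[]/eqP ->.
  by rewrite inE => /eqP ->.
have nec f : T f -> T (Box f).
  move=> Tf; have [h|h] := MT _ _ (msi_rs_nec hM f).
    by rewrite !inE => /eqP ->.
  by rewrite inE => /eqP ->.
pose s f g n := if n is 0 then f else g : form.
split=> // [|f g|f|f|f g].
- by split=> // f /logic_ipc If; apply: ax => L hL _ _; apply: If.
- by apply: ax => L hL _ _; exact: (logic_subst hL (s f g) (logic_boxK hL)).
- apply: ax => L hL h1 _; apply: (logic_subst hL (s f f) (f := Imp (Var 0) (Box (Var 0)))).
  by apply: h1 => L' hL' h1' _; apply: h1' => L'' _ _; apply.
- apply: ax => L hL h1 _.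
  apply: (logic_subst hL (s f f) (f := Imp (Imp (Box (Var 0)) (Var 0)) (Var 0))).
  by apply: h1 => L' _ _; apply.
- apply: ax => L hL _ h2.
  by apply: (logic_subst hL (s f g) (h2 _ erefl)).
Qed.

(** * Subformula-closed lists *)

Definition immediate_subformulas (f : form) : seq form :=
  match f with
  | And g h | Or g h | Imp g h => [:: g; h]
  | Box g => [:: g]
  | _ => [::]
  end.

Definition subformula_closed (B : seq form) :=
  forall f g, f \in B -> g \in immediate_subformulas f -> g \in B.

Lemma subformula_closed_cat B B' :
  subformula_closed B -> subformula_closed B' -> subformula_closed (B ++ B').
Proof.
move=> hB hB' f g; rewrite !mem_cat => /orP[fB|fB'] gf.
  by rewrite (hB _ _ fB gf).
by rewrite (hB' _ _ fB' gf) orbT.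
Qed.

Lemma subformula_closed_cons f B : {subset immediate_subformulas f <= B} ->
  subformula_closed B -> subformula_closed (f :: B).
Proof.
move=> fB hB g h; rewrite !inE => /predU1P[->|gB] hg; first by rewrite fB ?orbT.
by rewrite (hB _ _ gB hg) orbT.
Qed.

Lemma subformulas_exist f : exists2 B, subformula_closed B & f \in B.
Proof.
elim: f => [n|||f [X hX fX] g [Y hY gY]|f [X hX fX] g [Y hY gY]
  |f [X hX fX] g [Y hY gY]|f [X hX fX]].
- by exists [:: Var n]; [apply: subformula_closed_cons|rewrite inE].
- by exists [:: Bot]; [apply: subformula_closed_cons|rewrite inE].
- by exists [:: Top]; [apply: subformula_closed_cons|rewrite inE].
1-3: eexists; [apply: (@subformula_closed_cons _ (X ++ Y)) | exact: mem_head].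
1,3,5: by move=> k; rewrite !inE mem_cat => /orP[]/eqP ->; rewrite ?fX ?gY ?orbT.
1-3: exact: subformula_closed_cat.
exists (Box f :: X); last exact: mem_head.
by apply: subformula_closed_cons => // k; rewrite inE => /eqP ->.
Qed.

Lemma subformula_closure_exists (S : seq form) :
  exists2 B, subformula_closed B & {subset S <= B}.
Proof.
elim: S => [|f S [B hB SB]]; first by exists [::].
have [X hX fX] := subformulas_exist f.
exists (X ++ B); first exact: subformula_closed_cat.
by move=> g; rewrite inE mem_cat => /predU1P[->|/SB ->]; rewrite ?fX ?orbT.
Qed.

(** * The canonical rule of the quotient *)

(** [T] is an arbitrary set, so the criterion also applies to the preimage of a theory under a
    substitution. *)
Lemma psc_premisesP (d : Order.disp_t) (H : finFrontonType d)
    (Dimp : {set H * H}) (Dbox : {set H}) (p : H -> nat) (T : set form) :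
  (forall f, f \in psc_premises Dimp Dbox p -> T f) <->
  [/\ T (Iff (Var (p \bot%O)) Bot) /\ T (Iff (Var (p \top%O)) Top),
    forall a b, T (Iff (Var (p (a `&` b)%O)) (And (Var (p a)) (Var (p b)))),
    forall a b, T (Iff (Var (p (a `|` b)%O)) (Or (Var (p a)) (Var (p b)))),
    forall a b, (a, b) \in Dimp ->
      T (Iff (Var (p (himp a b))) (Imp (Var (p a)) (Var (p b)))) &
    forall a, a \in Dbox -> T (Iff (Var (p (hbox a))) (Box (Var (p a))))].
Proof.
split=> [HT|[[T0 T1] TI TU Tm Tb] f].
  split=> [|a b|a b|a b ab|a ab].
  - by split; apply: HT; rewrite !inE eqxx ?orbT.
  - apply: HT; rewrite !in_fsetU; do 3!(apply/orP; left); apply/orP; right.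
    by apply/imfset2P; exists a => //; exists b.
  - apply: HT; rewrite !in_fsetU; do 2!(apply/orP; left); apply/orP; right.
    by apply/imfset2P; exists a => //; exists b.
  - apply: HT; rewrite !in_fsetU; do 1!(apply/orP; left); apply/orP; right.
    by apply/imfsetP; exists (a, b).
  - apply: HT; rewrite !in_fsetU; apply/orP; right.
    by apply/imfsetP; exists a.
rewrite !in_fsetU => /orP[/orP[/orP[/orP[]|]|]|].
- by rewrite !inE => /orP[]/eqP ->.
- by case/imfset2P => a _ [b _ ->].
- by case/imfset2P => a _ [b _ ->].
- by case/imfsetP => -[a b] /= ab ->; apply: Tm.
- by case/imfsetP => a /= ab ->; apply: Tb.
Qed.

Section Canonical.
Variables (T : set form) (KMT : KM_theory T).
Variables (B G : seq form) (hB : subformula_closed B).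
Hypothesis hG : sublattice_section T G.
Hypothesis G_closure : forall g, g \in G -> closure [set` B] [set` B] g.
Hypothesis closure_G : forall f, closure [set` B] [set` B] f ->
  exists2 g, g \in G & T (Iff f g).

Let hT := KM_thy KMT.
Notation H := (quotient hT hG).
Notation cls := (@class T hT G hG).

Definition canonical_imp : {set H * H} := finset (fun ab =>
  `[< T (Iff (Imp (repr ab.1) (repr ab.2)) (repr (himp ab.1 ab.2))) >]).

(* The second conjunct makes the pair compatible; it costs nothing, since H is
   closed under implications into every boxed subformula. *)
Definition canonical_box : {set H} := finset (fun a =>
  `[< T (Iff (Box (repr a)) (repr (hbox a))) >] &&
  [forall b, (b, a) \in canonical_imp]).

Lemma canonical_compatible : psc_compatible canonical_imp canonical_box.
Proof. by move=> a; rewrite inE => /andP[_ /forallP]. Qed.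

Lemma repr_class f : f \in B -> T (Iff f (repr (cls f))).
Proof. by move=> fB; apply: classP; apply: closure_G; apply: closure_gen. Qed.

(** Valid for every [b]: its representative lies in the closure, which contains the implications
    from its members into [B]. *)
Lemma class_canonical_imp b f : f \in B -> (b, cls f) \in canonical_imp.
Proof.
move=> fB; rewrite inE; apply/asboolP/(@repr_himp T hT G hG) => /=.
have [h hh ?] := closure_G (closure_imp (G_closure (repr_in b)) fB).
by exists h => //; have ? := repr_class fB; ipc.
Qed.

Lemma class_canonical_box f : Box f \in B -> cls f \in canonical_box.
Proof.
move=> BfB; have fB : f \in B by apply: hB BfB _; rewrite inE.
have fI b := class_canonical_imp b fB.
rewrite inE; apply/andP; split; last exact/forallP.
apply/asboolP/(@repr_hbox T hT G hG) => // [b|].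
  have [h hh ?] := closure_G (closure_imp (G_closure (repr_in b)) fB).
  by exists h => //; have ? := repr_class fB; ipc.
have [h hh ?] := closure_G (closure_gen _ BfB); exists h => //.
by have ? := iff_box KMT (repr_class fB); ipc.
Qed.

Lemma class_eq f (a : H) : f \in B -> T (Iff f (repr a)) -> cls f = a.
Proof.
by move=> /repr_class ? ?; apply: (quotient_inj (hT := hT) (hG := hG)); ipc.
Qed.

Lemma class_and f g : And f g \in B -> cls (And f g) = (cls f `&` cls g)%O.
Proof.
move=> fgB; apply: (class_eq fgB (iff_trans hT _ (repr_meet _ _))).
have ? := repr_class (hB fgB (mem_head _ _)).
by have /= ? := repr_class (hB fgB (mem_last f [:: g])); ipc.
Qed.

Lemma class_or f g : Or f g \in B -> cls (Or f g) = (cls f `|` cls g)%O.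
Proof.
move=> fgB; apply: (class_eq fgB (iff_trans hT _ (repr_join _ _))).
have ? := repr_class (hB fgB (mem_head _ _)).
by have /= ? := repr_class (hB fgB (mem_last f [:: g])); ipc.
Qed.

Lemma class_imp f g : Imp f g \in B -> cls (Imp f g) = himp (cls f) (cls g).
Proof.
move=> fgB; have /= gB := hB fgB (mem_last f [:: g]).
have := class_canonical_imp (cls f) gB; rewrite inE => /asboolP /= fgE.
apply: (class_eq fgB (iff_trans hT _ fgE)).
have ? := repr_class (hB fgB (mem_head _ _)).
by have ? := repr_class gB; ipc.
Qed.

Lemma class_box f : Box f \in B -> cls (Box f) = hbox (cls f).
Proof.
move=> fB; have := class_canonical_box fB; rewrite inE => /andP[/asboolP /= fE _].
apply: (class_eq fB (iff_trans hT _ fE)).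
exact: iff_box KMT (repr_class (hB fB (mem_head _ _))).
Qed.

Variables (p : H -> nat) (p_inj : injective p).

(** Each variable is replaced by the representative of its element. The premises then belong to [T]
    by the choice of the two domains, whereas a conclusion in [T] would identify two distinct
    elements. *)
Lemma canonical_rule_refuted M : rule_system M -> closed_under M T ->
  ~ M (psc_rule canonical_imp canonical_box p).
Proof.
move=> hM MT /(rs_structural hM).
pose s n := if [pick a | p a == n] is Some a then repr a else Bot.
have sp a : s (p a) = repr a.
  rewrite /s; case: pickP => [b /eqP/p_inj -> //|/(_ a)].
  by rewrite eqxx.
move=> /(_ s) /MT[f /imfsetP[g /= gprem ->]|f].
  move: g gprem; apply/(psc_premisesP _ _ _ [set g | T (subst s g)]).
  split=> /= [|a b|a b|a b|a]; rewrite ?sp.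
  - by split; apply: (iff_sym hT); [exact: repr_bot|exact: repr_top].
  - by apply: (iff_sym hT); apply: repr_meet.
  - by apply: (iff_sym hT); apply: repr_join.
  - by rewrite inE => /asboolP; apply: iff_sym.
  - by rewrite inE => /andP[/asboolP + _]; apply: iff_sym.
move=> /imfsetP[g /= /imfsetP[[a b] /= ab ->] ->] /=; rewrite !sp.
by move=> /(quotient_inj (hT := hT) (hG := hG)) abE; move: ab; rewrite abE inE /= eqxx.
Qed.

(** The premises make [a |-> p a] commute, in [T2], with every operation occurring in [B]: the
    lattice operations everywhere, implications and boxes by membership in the domains. Induction on
    [f] concludes. *)
Lemma canonical_rule_reflects T2 : KM_theory T2 ->
  (forall f, f \in psc_premises canonical_imp canonical_box p -> T2 f) ->
  forall f, f \in B ->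
  T2 (Iff (subst (fun n => Var (p (cls (Var n)))) f) (Var (p (cls f)))).
Proof.
move=> KM2 /psc_premisesP[[Tbot Ttop] TI TU Tm Tb]; have h2 := KM_thy KM2.
have eq_trans x y z : T2 (Iff x y) -> T2 (Iff z y) -> T2 (Iff x z).
  by move=> xy /(iff_sym h2); apply: iff_trans.
elim=> [n|||f IHf g IHg|f IHf g IHg|f IHf g IHg|f IHf] /= fB.
- by ipc.
- exact: iff_sym.
- exact: iff_sym.
- have ? := IHf (hB fB (mem_head _ _)).
  have /= ? := IHg (hB fB (mem_last f [:: g])).
  by rewrite class_and //; apply: eq_trans (TI _ _); ipc.
- have ? := IHf (hB fB (mem_head _ _)).
  have /= ? := IHg (hB fB (mem_last f [:: g])).
  by rewrite class_or //; apply: eq_trans (TU _ _); ipc.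
- have /= gB := hB fB (mem_last f [:: g]).
  have ? := IHf (hB fB (mem_head _ _)); have ? := IHg gB.
  rewrite class_imp //; apply: eq_trans (Tm _ _ (class_canonical_imp _ gB)).
  by ipc.
- rewrite class_box //; apply: eq_trans (Tb _ (class_canonical_box fB)).
  exact: iff_box KM2 (IHf (hB fB (mem_head _ _))).
Qed.

Lemma class_top f : f \in B -> (cls f = \top%O) <-> T f.
Proof.
move=> fB; split=> [fE|?]; last first.
  by apply: (class_eq fB (iff_trans hT _ (repr_top hT hG))); ipc.
have fTop : T (Iff f Top).
  apply: (iff_trans hT (repr_class fB)); rewrite fE.
  by apply: (iff_sym hT); apply: repr_top.
by ipc.
Qed.

End Canonical.

(** * Axiomatisation by canonical rules *)

Lemma msi_rule_system_oplus S X : msi_rule_system (rule_oplus S X).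
Proof.
split=> [|f If M hM _ _|f g M hM _ _|f M hM _ _].
- split=> [s G D GD M hM SM XM|f M hM _ _|G D G' D' GD M hM SM XM|
    G D f GD1 GD2 M hM SM XM]; have rM := msi_rs_system hM.
  + exact: (rs_structural rM s (GD M hM SM XM)).
  + exact: (rs_refl rM).
  + exact: (rs_mono rM _ _ (GD M hM SM XM)).
  + exact: (rs_cut rM (GD1 M hM SM XM) (GD2 M hM SM XM)).
- exact: (msi_rs_ipck hM If).
- exact: (msi_rs_mp hM).
- exact: (msi_rs_nec hM).
Qed.

Theorem theorem5p18 (L : set rule) (hL : NExt KM_R L) :
  exists X : set rule,
    (forall r : rule, X r -> is_pre_stable_canonical_rule r) /\
    axiomatised_over KM_R L X.
Proof.
have [msiL KM_L] := hL.
exists [set r | is_pre_stable_canonical_rule r /\ L r]; split; first by move=> r [].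
set X := (X in axiomatised_over _ _ X); set M := rule_oplus KM_R X.
have msiM : msi_rule_system M by exact: msi_rule_system_oplus.
have KM_M : KM_R `<=` M by move=> r Kr S _ KS _; exact: KS.
(* Only the inclusion of [L] in [M] has content; the converse holds as [L] is among the systems that
   [M] intersects. *)
apply/seteqP; split=> [[G0 D0] Lr|r]; last by apply=> // s [].
apply: contrapT => /(lindenbaum (msi_rs_system msiM))[T [MT G0T D0T]].
have KMT := closed_under_KM_theory msiM KM_M MT; pose hT := KM_thy KMT.
have [B hB GDB] := subformula_closure_exists (G0 ++ D0).
have [||||G [hG GC CG]] :=
    @sublattice_section_exists T (closure [set` B] [set` B]) hT (finite_closure hT B B).
- exact: closure_bot.
- exact: closure_top.
- exact: closure_and.
- exact: closure_or.
pose p (a : quotient hT hG) : nat := enum_rank a.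
have p_inj : injective p by move=> a b /val_inj/enum_rank_inj.
have := canonical_rule_refuted p_inj (msi_rs_system msiM) MT.
set Dimp := canonical_imp _ _; set Dbox := canonical_box _ _ => nM.
(* Canonical rules in [L] belong to [M] by the choice of [X]. *)
have nL : ~ L (psc_rule Dimp Dbox p).
  move=> Lc; apply: nM => S _ _; apply; split=> //.
  exists _, (quotient hT hG), Dimp, Dbox, p; split=> //.
  exact: canonical_compatible.
(* A second Lindenbaum set, closed under [L], refutes the canonical rule; a substitution instance of
   the original rule is then applied in it. *)
have [T2 [LT2 prem concl]] := lindenbaum (msi_rs_system msiL) nL.
have KM2 := closed_under_KM_theory msiL KM_L LT2; have h2 := KM_thy KM2.
have refl := canonical_rule_reflects hB GC CG KM2 prem.
have top2 : T2 (Var (p \top%O)).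
  case/psc_premisesP: prem => -[_ /(thy_andE h2)[_ topE]] *.
  exact: (thy_mp h2 topE (thy_top h2)).
have [f|f] := LT2 _ _ (rs_structural (msi_rs_system msiL)
  (fun n => Var (p (class hT hG (Var n)))) Lr).
  case/imfsetP => g /= gG0 ->; have gB : g \in B by apply: GDB; rewrite mem_cat gG0.
  have := refl _ gB; rewrite (iffRL (class_top KMT hG CG gB)); last exact: G0T.
  by move/(thy_andE h2) => [_ /(thy_mp h2)]; apply.
case/imfsetP => g /= gD0 ->; have gB : g \in B by apply: GDB; rewrite mem_cat gD0 orbT.
move=> T2g; have /(thy_andE h2)[/(thy_mp h2)/(_ T2g) T2p _] := refl _ gB.
case: (D0T _ gD0); apply/(class_top KMT hG CG gB); apply: contrapT => gE.
(* When the class of [g] is not the top, this equivalence is a conclusion of the canonical rule,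
   which [T2] omits; yet both of its sides belong to [T2]. *)
apply: (concl (Iff (Var (p (class hT hG g))) (Var (p \top%O)))).
  apply/imfsetP; exists (class hT hG g, \top%O) => //=.
  by rewrite inE; apply/eqP.
by apply: (thy_andI h2); apply: (thy_weak h2).
Qed.
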